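(* Let $G$ be a countable abelian group such that $G\cong\bigoplus_{n\in\mathbb{N}} G$. Then there is a comeager set $\mathcal{M}$ of invariant metrics on $G$ such that for any $d,d'\in\mathcal{M}$ the completions of $(G,d)$ and $(G,d')$ are the same metric group, i.e. there is a group isomorphism between the completions which is an isometry.
   Context: Abelian groups are written additively. A metric $d$ on an abelian group $G$ is invariant if $d(a,b)=d(a+c,b+c)$ for all $a,b,c\in G$. The space of all invariant metrics on a countable group $G$ is a subset of $\mathbb{R}^{G\times G}$ and carries the subspace topology of the product topology (pointwise convergence), with which it is a Polish space; ''comeager'' refers to this space. The completion of $(G,d)$ is the metric completion with the group operations extended by continuity; it is an abelian group with a complete invariant metric. *)

(* Defs.v *)
From HB Require Import structures.
From mathcomp Require Import all_boot all_order all_algebra.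
From mathcomp Require Import boolp classical_sets functions cardinality.
From mathcomp Require Import reals interval_inference.
From mathcomp Require Import topology normedtype sequences.
From mathcomp Require Import borel_hierarchy.

Set Implicit Arguments.
Unset Strict Implicit.
Unset Printing Implicit Defensive.

Import Order.TTheory GRing.Theory Num.Theory.
Import numFieldNormedType.Exports.

Local Open Scope classical_set_scope.
Local Open Scope ring_scope.
Local Open Scope quotient_scope.

Definition comeager (T : topologicalType) (M : set T) : Prop :=
  exists2 S : set T, Gdelta_dense S & S `<=` M.

Definition group_isomorphic (U V : zmodType) : Prop :=
  exists f : {additive U -> V}, bijective f.

Section DirectSum.
Variable G : zmodType.

Definition finitely_supported : {pred nat -> G} :=
  [pred f | `[< finite_set [set n | f n != 0] >]].

Lemma finitely_supported_zmod_closed : zmod_closed finitely_supported.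
Proof.
split=> [|f g /asboolP ff /asboolP fg]; apply/asboolP.
  by apply: (@sub_finite_set _ _ set0) => // n /=; rewrite eqxx.
apply: (sub_finite_set _ (_ : finite_set
  ([set n | f n != 0] `|` [set n | g n != 0]))); last by rewrite finite_setU.
move=> n /= fgn; have [f0|] := eqVneq (f n) 0; last by left.
right; apply: contra_neq fgn => g0.
by rewrite -[LHS]/(f n - g n) f0 g0 subrr.
Qed.

HB.instance Definition _ := GRing.isZmodClosed.Build (nat -> G)
  finitely_supported finitely_supported_zmod_closed.

Definition direct_sum : Type := {f : nat -> G | f \in finitely_supported}.

HB.instance Definition _ := SubChoice.on direct_sum.
HB.instance Definition _ := [SubChoice_isSubZmodule of direct_sum by <:].

End DirectSum.

Section InvariantMetrics.
Variables (R : realType) (G : zmodType).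

Definition is_metric (d : G * G -> R) : Prop :=
  [/\ forall a b, 0 <= d (a, b),
      forall a b, d (a, b) = 0 <-> a = b,
      forall a b, d (a, b) = d (b, a) &
      forall a b c, d (a, c) <= d (a, b) + d (b, c)].

Definition is_invariant (d : G * G -> R) : Prop :=
  forall a b c, d (a, b) = d (a + c, b + c).

(* As a type, this set carries the topology induced by the product topology
   (topology of pointwise convergence) of [{ptws G * G -> R}]. *)
Definition invariant_metrics : set {ptws (G * G)%type -> R} :=
  [set d | is_metric d /\ is_invariant d].

End InvariantMetrics.

Arguments invariant_metrics : clear implicits.

Section Completion.
Variables (R : realType) (G : zmodType) (d : invariant_metrics R G).

Local Notation dist a b := ((set_val d : G * G -> R) (a, b)).

Let dist_is : is_metric (set_val d) /\ is_invariant (set_val d).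
Proof. exact: set_valP d. Qed.

Lemma im_ge0 a b : 0 <= dist a b. Proof. by have [[]] := dist_is. Qed.
Lemma im_eq0 a b : dist a b = 0 <-> a = b.
Proof. by have [[]] := dist_is. Qed.
Lemma im_xx a : dist a a = 0. Proof. exact/im_eq0. Qed.
Lemma im_sym a b : dist a b = dist b a. Proof. by have [[]] := dist_is. Qed.
Lemma im_triangle b a c : dist a c <= dist a b + dist b c.
Proof. by have [[]] := dist_is. Qed.
Lemma im_inv c a b : dist (a + c) (b + c) = dist a b.
Proof. by have [_ /(_ a b c) <-] := dist_is. Qed.
Lemma im_sub a b : dist a b = dist (a - b) 0.
Proof. by rewrite -(im_inv (- b)) subrr. Qed.
Lemma im_opp a b : dist (- a) (- b) = dist a b.
Proof. by rewrite -(im_inv (a + b)) addrA addNr add0r addrC addrK im_sym. Qed.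
Lemma im_add a b a' b' : dist (a + b) (a' + b') <= dist a a' + dist b b'.
Proof.
apply: (le_trans (im_triangle (a' + b) _ _)).
by rewrite im_inv ![a' + _]addrC im_inv.
Qed.

Definition cauchy_seq : {pred nat -> G} :=
  [pred u | `[< forall e : R, 0 < e -> exists N, forall m n,
    (N <= m)%N -> (N <= n)%N -> dist (u m) (u n) < e >]].

Lemma cauchy_seq_zmod_closed : zmod_closed cauchy_seq.
Proof.
split=> [|u v /asboolP cu /asboolP cv]; apply/asboolP => e e0.
  by exists 0%N => m n _ _; rewrite im_xx.
have e20 : 0 < e / 2 by rewrite divr_gt0.
have [N1 uN] := cu _ e20; have [N2 vN] := cv _ e20.
exists (maxn N1 N2) => m n; rewrite !geq_max => /andP[m1 m2] /andP[n1 n2].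
apply: (le_lt_trans (im_add (u m) (- v m) (u n) (- v n))).
by rewrite im_opp [e]splitr ltrD ?uN ?vN.
Qed.

HB.instance Definition _ := GRing.isZmodClosed.Build (nat -> G)
  cauchy_seq cauchy_seq_zmod_closed.

Definition cauchySeq : Type := {u : nat -> G | u \in cauchy_seq}.

HB.instance Definition _ := SubChoice.on cauchySeq.
HB.instance Definition _ := [SubChoice_isSubZmodule of cauchySeq by <:].

Definition null_seq : {pred cauchySeq} :=
  [pred u : cauchySeq | `[< (fun n => dist (val u n) 0) @ \oo --> (0 : R) >]].

Lemma null_seq_zmod_closed : zmod_closed null_seq.
Proof.
split=> [|u v /asboolP nu /asboolP nv]; apply/asboolP.
  by under eq_fun do rewrite im_xx; exact: cvg_cst.
apply: (@squeeze_cvgr _ _ _ _ (cst 0)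
  ((fun n => dist (val u n) 0) \+ (fun n => dist (val v n) 0))).
- near=> n; rewrite /= im_ge0/=.
  by rewrite -{1}(subr0 0) (le_trans (im_add _ _ _ _))// im_opp.
- exact: cvg_cst.
- by rewrite -[X in _ --> X]addr0; exact: cvgD.
Unshelve. all: by end_near. Qed.

HB.instance Definition _ := GRing.isZmodClosed.Build cauchySeq
  null_seq null_seq_zmod_closed.

(* Cauchy sequences [u], [v] are identified when [u - v] is a null sequence;
   by invariance, this is the usual condition [dist (u n) (v n) --> 0]. *)
Definition completion : Type := {ideal_quot null_seq}.

HB.instance Definition _ := GRing.Zmodule.on completion.

Definition completion_dist (x y : completion) : R :=
  limn (fun n => dist (val (repr x) n) (val (repr y) n)).

Lemma im_dist_le a b a' b' :
  `|dist a b - dist a' b'| <= dist a a' + dist b b'.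
Proof.
have tri x y x' y' : dist x y - dist x' y' <= dist x x' + dist y y'.
  rewrite lerBlDr (le_trans (im_triangle x' _ _))// -addrA lerD2l.
  by rewrite addrC (le_trans (im_triangle y' _ _))// lerD2l im_sym.
rewrite ler_norml tri andbT lerNl opprB (le_trans (tri _ _ _ _))//.
by rewrite [dist a' a]im_sym [dist b' b]im_sym.
Qed.

Lemma cauchy_seqP (u : cauchySeq) (e : R) : 0 < e ->
  exists N, forall m n, (N <= m)%N -> (N <= n)%N ->
    dist (val u m) (val u n) < e.
Proof. by move=> e0; have /asboolP/(_ e e0) := valP u. Qed.

Lemma is_cvg_dist (u v : cauchySeq) :
  cvgn (fun n => dist (val u n) (val v n)).
Proof.
apply/cauchy_cvgP; apply: cauchy_exP => e e0.
have e20 : 0 < e / 2 by rewrite divr_gt0.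
have [N1 uN] := cauchy_seqP u e20; have [N2 vN] := cauchy_seqP v e20.
pose N := maxn N1 N2; exists (dist (val u N) (val v N)).
exists N => // n /=; rewrite geq_max => /andP[n1 n2].
rewrite /ball/= (le_lt_trans (im_dist_le _ _ _ _))// [e]splitr.
by rewrite ltrD ?uN ?vN ?leq_maxl ?leq_maxr.
Qed.

Lemma repr_null (u : cauchySeq) :
  (fun n => dist (val (repr (\pi_completion u)) n) (val u n)) @ \oo --> (0 : R).
Proof.
have : repr (\pi_completion u) - u \in null_seq.
  by rewrite Quotient.idealrBE reprK.
move=> /asboolP; apply: cvg_trans; apply: near_eq_cvg; near=> n.
by rewrite /= [RHS]im_sub.
Unshelve. all: by end_near. Qed.

Lemma cvg_completion_dist (u v : cauchySeq) :
  (fun n => dist (val u n) (val v n)) @ \oo -->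
    completion_dist (\pi_completion u) (\pi_completion v).
Proof.
set u' := repr (\pi_completion u); set v' := repr (\pi_completion v).
have H : (fun n => dist (val u n) (val v n) - dist (val u' n) (val v' n)) @ \oo
    --> (0 : R).
  apply/norm_cvg0P; apply: (@squeeze_cvgr _ _ _ _ (cst 0)
    ((fun n => dist (val u' n) (val u n)) \+
     (fun n => dist (val v' n) (val v n)))).
  - near=> n; rewrite normr_ge0/= (le_trans (im_dist_le _ _ _ _))//.
    by rewrite [dist _ (val u' n)]im_sym [dist _ (val v' n)]im_sym.
  - exact: cvg_cst.
  - by rewrite -[X in _ --> X]addr0; apply: cvgD; exact: repr_null.
have K := cvgD H (@is_cvg_dist u' v'); rewrite add0r in K.
rewrite (_ : (fun n => _) = (fun n => dist (val u n) (val v n) -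
  dist (val u' n) (val v' n)) + (fun n => dist (val u' n) (val v' n))).
  exact: K.
by apply/funext => n; rewrite -[RHS]/(_ - _ + _) subrK.
Unshelve. all: by end_near. Qed.

Lemma completion_distE (u v : cauchySeq) :
  completion_dist (\pi_completion u) (\pi_completion v) =
  limn (fun n => dist (val u n) (val v n)).
Proof. by apply/esym/cvg_lim => //; exact: cvg_completion_dist. Qed.

Lemma completion_distxx x : completion_dist x x = 0.
Proof.
rewrite /completion_dist; under eq_fun do rewrite im_xx.
by apply/cvg_lim => //; exact: cvg_cst.
Qed.

Lemma completion_dist_sym x y : completion_dist x y = completion_dist y x.
Proof.
rewrite /completion_dist; congr (limn _); apply/funext => n.
by rewrite im_sym.
Qed.

Lemma completion_dist_triangle y x z :
  completion_dist x z <= completion_dist x y + completion_dist y z.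
Proof.
rewrite /completion_dist -limD; [|exact: is_cvg_dist..].
apply: ler_lim; [exact: is_cvg_dist| |].
  by apply: is_cvgD; exact: is_cvg_dist.
by near=> n; exact: im_triangle.
Unshelve. all: by end_near. Qed.

Lemma completion_dist_eq0 x y : completion_dist x y = 0 -> x = y.
Proof.
move=> xy0; rewrite -[x]reprK -[y]reprK; apply/eqP.
rewrite -Quotient.idealrBE; apply/asboolP; rewrite -xy0.
apply: cvg_trans (@is_cvg_dist (repr x) (repr y)).
by apply: near_eq_cvg; near=> n; rewrite /= [LHS]im_sub.
Unshelve. all: by end_near. Qed.

HB.instance Definition _ := isMetric.Build R completion completion_distxx
  completion_dist_eq0 completion_dist_sym completion_dist_triangle.

Lemma completion_mdistE (x y : completion) : mdist x y = completion_dist x y.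
Proof. by []. Qed.

Lemma completion_invariant (x y z : completion) :
  mdist x y = mdist (x + z) (y + z).
Proof.
rewrite !completion_mdistE -[x]reprK -[y]reprK -[z]reprK -!raddfD.
rewrite !completion_distE; congr (limn _); apply/funext => n.
by rewrite -(im_inv (val (repr z) n)).
Qed.

Lemma cst_cauchy (a : G) : (fun=> a) \in cauchy_seq.
Proof. by apply/asboolP => e e0; exists 0%N => m n _ _; rewrite im_xx. Qed.

Definition to_completion (a : G) : completion :=
  \pi_completion (exist _ (fun=> a) (cst_cauchy a) : cauchySeq).

Lemma to_completionD : {morph to_completion : a b / a + b}.
Proof.
by move=> a b; rewrite /to_completion -raddfD; congr (\pi_completion _); exact: val_inj.
Qed.

Lemma to_completion_isometry (a b : G) :
  mdist (to_completion a) (to_completion b) = dist a b.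
Proof.
rewrite completion_mdistE completion_distE.
by rewrite -[RHS](lim_cst (@Rhausdorff R) (F := \oo)).
Qed.

Lemma to_completion_approx (u : cauchySeq) (e : R) : 0 < e ->
  exists N, forall n, (N <= n)%N ->
    mdist (to_completion (val u n)) (\pi_completion u) < e.
Proof.
move=> e0; have e20 : 0 < e / 2 by rewrite divr_gt0.
have [N uN] := cauchy_seqP u e20; exists N => n Nn.
apply: (@le_lt_trans _ _ (e / 2)); last by rewrite [ltRHS]splitr ltrDl.
rewrite completion_mdistE completion_distE; apply: limr_le.
  exact: is_cvg_dist.
by near=> m; rewrite ltW//= uN//; near: m; exact: nbhs_infty_ge.
Unshelve. all: by end_near. Qed.

Lemma dense_to_completion : dense (range to_completion).
Proof.
move=> D [x Dx] oD; have : nbhs x D by exact: open_nbhs_nbhs.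
rewrite -nbhs_ballE => -[e /= e0 xeD].
have [N xN] := to_completion_approx (repr x) e0.
exists (to_completion (val (repr x) N)); split; last by exists (val (repr x) N).
apply: xeD; rewrite ballEmdist/= metric_sym.
by have := xN _ (leqnn N); rewrite reprK.
Qed.

HB.instance Definition _ := isPointed.Build completion 0.

Lemma completion_complete (F : set_system completion) :
  ProperFilter F -> cauchy F -> cvg F.
Proof.
move=> FF /cauchyP Fc.
have inv_gt0 n : (0 : R) < n.+1%:R^-1 by rewrite invr_gt0.
have : forall n, exists a, F (ball (to_completion a) n.+1%:R^-1).
  move=> n; have e0 : 0 < n.+1%:R^-1 / 2 :> R by rewrite divr_gt0.
  have [x Fx] := Fc _ e0; have [N xN] := to_completion_approx (repr x) e0.
  exists (val (repr x) N); apply: filterS Fx => y.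
  rewrite !ballEmdist/= => xy; have := xN _ (leqnn N); rewrite reprK => ax.
  rewrite (le_lt_trans (metric_triangle _ x _))// [ltRHS]splitr.
  exact: ltrD.
move=> /choice[g gF].
have dg m n : dist (g m) (g n) < m.+1%:R^-1 + n.+1%:R^-1.
  have [y []] := filter_ex (filterI (gF m) (gF n)).
  rewrite !ballEmdist/= => my ny; rewrite -to_completion_isometry.
  rewrite (le_lt_trans (metric_triangle _ y _))// ltrD//.
  by rewrite metric_sym.
have small (e : R) : 0 < e -> exists N, forall n, (N <= n)%N -> n.+1%:R^-1 < e.
  move=> e0; have [N _ HN] := near_infty_natSinv_lt (PosNum e0).
  by exists N => n Nn; exact: HN.
have gc : g \in cauchy_seq.
  apply/asboolP => e e0; have [N HN] := small _ (divr_gt0 e0 (ltr0Sn R 1)).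
  exists N => m n Nm Nn; rewrite (lt_trans (dg m n))// [ltRHS]splitr.
  by rewrite ltrD ?HN.
pose u : cauchySeq := exist _ g gc.
apply/cvg_ex; exists (\pi_completion u); apply/cvg_ballP => e e0.
have e20 : 0 < e / 2 by rewrite divr_gt0.
have [N1 H1] := small _ e20; have [N2 H2] := to_completion_approx u e20.
pose N := maxn N1 N2; apply: filterS (gF N) => y; rewrite !ballEmdist/= => Ny.
rewrite (le_lt_trans (metric_triangle _ (to_completion (g N)) _))//.
rewrite [e]splitr ltrD// ?(lt_trans Ny) ?H1 ?leq_maxl//.
by rewrite metric_sym H2 ?leq_maxr.
Qed.

HB.instance Definition _ :=
  Uniform_isComplete.Build completion completion_complete.

End Completion.

(* Main.v *)
Require Import Defs.
From HB Require Import structures.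
From mathcomp Require Import all_boot all_order all_algebra.
From mathcomp Require Import boolp classical_sets functions cardinality.
From mathcomp Require Import reals interval_inference.
From mathcomp Require Import topology normedtype sequences.
From mathcomp Require Import borel_hierarchy.
From mathcomp Require Import lra.

Set Implicit Arguments.
Unset Strict Implicit.
Unset Printing Implicit Defensive.

Import Order.TTheory GRing.Theory Num.Theory.
Import numFieldNormedType.Exports.

Local Open Scope classical_set_scope.
Local Open Scope ring_scope.
Local Open Scope quotient_scope.


(** An invariant metric on [G] amounts to the length [x |-> d (x, 0)], written
    [norm_of d]; a length that is not definite becomes one after adding a small
    constant off [0] ([invariant_metric_near]), so approximation arguments may
    be carried out with pseudonorms.

    A metric is called generic when it satisfies every finite list of strict
    constraints on the distances [d (f y, a)], for some endomorphism [f] of [G],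
    that metrics arbitrarily close to it satisfy, and when its length grows
    sublinearly along the multiples of every element. For each of the countably
    many rational constraint lists the satisfying metrics form an open set [U],
    and [U `|` ~` closure U] is open and dense; sublinear growth is a countable
    family of open conditions, dense because truncating a length makes it
    bounded. Hence generic metrics are comeager ([comeager_generic]).

    Two generic metrics [d] and [d'] are compared by approximate intertwining.
    Suppose the endomorphism [f] changes the length of each sum of [n] elements
    of a finite symmetric set [F] by at most [n t]. Gluing [(G, d)] and
    [(G, d')] along [f] at cost [t] gives a length on [G * G] that restricts to
    both given lengths and puts [x] and [f x] at distance at most [t]. Since [G]
    is a countable direct sum of copies of itself, any finite part of [G] leaves
    room for one more independent copy, so this glued length is realized by
    metrics on [G] arbitrarily close to [d]. By genericity [d] itself admits an
    endomorphism [g] with [g (f x)] within [2 t] of [x] on [F], and [g] as close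
    to isometric as desired on any finite set ([generic_extension]). The gluing
    needs control of sums of unbounded length, whereas genericity gives only
    finitely many estimates; sublinear growth makes long sums negligible and
    bridges this gap ([sublinear_control]).

    Iterating back and forth with errors [2 ^- n] yields sequences [f n] and
    [g n] of almost inverse almost isometries on sets that exhaust [G]
    ([exists_intertwined]). Their limits are mutually inverse isometric
    homomorphisms between the completions ([generic_isometric]). *)

(** * Comeager sets and enumerations *)

Lemma comeager_forall (T : topologicalType) (I : Type) (O : I -> set T) :
  countable [set: I] -> (forall i, open (O i)) -> (forall i, dense (O i)) ->
  comeager [set x | forall i, O i x].
Proof.
move=> /countable_injP[f finj] oO dO.
pose V n := if pselect (exists i, f i = n) is left h then O (sval (cid h))
            else setT.
exists (\bigcap_n V n); last first.
  move=> x Vx i; have := Vx (f i) Logic.I; rewrite /V.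
  case: pselect => [h|[]]; last by exists i.
  by case: (cid h) => j /= /finj; rewrite !inE => ->.
exists V => // n; rewrite /V; case: pselect => [h|_]; first by split.
by split; [exact: openT|move=> U U0 _; rewrite setIT].
Qed.

Lemma comeagerI (T : topologicalType) (A B : set T) :
  comeager A -> comeager B -> comeager (A `&` B).
Proof.
move=> [_ [F FP ->] FA] [_ [F' FP' ->] FB].
exists ((\bigcap_n F n) `&` (\bigcap_n F' n)); last exact: setISS.
exists (fun n => F n `&` F' n); last by rewrite bigcapI.
by move=> n; have [? ?] := FP n; have [? ?] := FP' n; split;
  [exact: openI|exact: denseI].
Qed.

Lemma open_decided (T : topologicalType) (U : set T) : open U ->
  open (U `|` ~` closure U).
Proof.
by move=> oU; apply: openU => //; apply/closed_openC/closed_closure.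
Qed.

(** A point is in the closure of [U], hence near [U], or already outside it. *)
Lemma dense_decided (T : topologicalType) (U : set T) :
  dense (U `|` ~` closure U).
Proof.
move=> V [x Vx] oV; have [Ux|nUx] := pselect (closure U x).
  have [y [Uy Vy]] := Ux V (open_nbhs_nbhs (conj oV Vx)).
  by exists y; split=> //; left.
by exists x; split=> //; right.
Qed.

Lemma exists_enumeration (T : Type) (x0 : T) : countable [set: T] ->
  exists e : nat -> T, forall x, exists n, e n = x.
Proof.
move=> /countable_injP[f finj].
have /choice[e eP] : forall n, exists x, (exists y, f y = n) -> f x = n.
  move=> n; have [[y <-]|no] := pselect (exists y, f y = n); first by exists y.
  by exists x0.
by exists e => x; exists (f x); apply: finj; rewrite ?inE//; apply: eP; exists x.
Qed.

(** * Lengths on abelian groups *)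

(** Definiteness is left out: a glued length need not be definite, and
    definiteness is restored at the end by an arbitrarily small change. *)
Definition pseudonorm (R : realType) (H : zmodType) (N : H -> R) : Prop :=
  [/\ N 0 = 0, forall x, N (- x) = N x & forall x y, N (x + y) <= N x + N y].

Section Pseudonorm.
Variables (R : realType) (H : zmodType) (N : H -> R).
Hypothesis hN : pseudonorm N.

Lemma pn0 : N 0 = 0. Proof. by case: hN. Qed.
Lemma pnN x : N (- x) = N x. Proof. by case: hN. Qed.
Lemma pnD x y : N (x + y) <= N x + N y. Proof. by case: hN. Qed.
Lemma pnB x y : N (x - y) <= N x + N y. Proof. by rewrite -(pnN y) pnD. Qed.
Lemma pn_distC x y : N (x - y) = N (y - x).
Proof. by rewrite -pnN opprB. Qed.
Lemma pn_ge0 x : 0 <= N x.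
Proof. by have := pnB x x; rewrite subrr pn0; lra. Qed.
Lemma pn_tri y x z : N (x - z) <= N (x - y) + N (y - z).
Proof. by rewrite -[x - z](subrKA y) pnD. Qed.

Lemma pn_sum (I : Type) (s : seq I) (F : I -> H) :
  N (\sum_(i <- s) F i) <= \sum_(i <- s) N (F i).
Proof.
elim: s => [|i s IHs]; first by rewrite !big_nil pn0.
by rewrite !big_cons (le_trans (pnD _ _))// lerD2l.
Qed.

Lemma pn_mulrn x n : N (x *+ n) <= N x *+ n.
Proof.
elim: n => [|n IHn]; first by rewrite !mulr0n pn0.
by rewrite !mulrS (le_trans (pnD _ _))// lerD2l.
Qed.

End Pseudonorm.

Lemma pseudonorm_comp (R : realType) (H H' : zmodType) (N : H -> R)
  (f : {additive H' -> H}) : pseudonorm N -> pseudonorm (N \o f).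
Proof.
move=> hN; split=> /= [|x|x y]; first by rewrite raddf0 (pn0 hN).
  by rewrite raddfN (pnN hN).
by rewrite raddfD (pnD hN).
Qed.

Section Norm.
Variables (R : realType) (G : zmodType).
Implicit Type d : invariant_metrics R G.

Definition norm_of d (x : G) : R := (set_val d : G * G -> R) (x, 0).

Lemma norm_ofB d a b : (set_val d : G * G -> R) (a, b) = norm_of d (a - b).
Proof. exact: im_sub. Qed.

Lemma pseudonorm_norm_of d : pseudonorm (norm_of d).
Proof.
split=> [|x|x y]; first exact: im_xx.
  by rewrite /norm_of -{1}oppr0 im_opp.
by rewrite /norm_of -{1}[0]addr0 im_add.
Qed.

(** Adding [e] off [0] makes a pseudonorm definite without breaking
    subadditivity. *)
Lemma invariant_metric_near (N : G -> R) (e : R) : pseudonorm N -> 0 < e ->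
  exists d, forall x, N x <= norm_of d x <= N x + e.
Proof.
move=> hN e0; pose M x : R := N x + (if x == 0 then 0 else e).
pose m : {ptws (G * G)%type -> R} := fun p => M (p.1 - p.2).
have mP : m \in invariant_metrics R G.
  apply/mem_set; split; first split.
  - by move=> a b; rewrite /m/M addr_ge0 ?(pn_ge0 hN)//; case: ifP => // _; lra.
  - move=> a b; rewrite /m/M/= subr_eq0; case: eqP => [->|ab].
      by rewrite subrr (pn0 hN) addr0.
    by split=> // /eqP; rewrite gt_eqF// ltr_wpDl// (pn_ge0 hN).
  - by move=> a b; rewrite /m/M/= (pn_distC hN) !subr_eq0 [a == b]eq_sym.
  - move=> a b c; rewrite /m/M/= !subr_eq0; have := pn_tri hN b a c.
    have [<-|ab] := eqVneq a b; first by rewrite subrr (pn0 hN) !add0r lexx.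
    have [<-|ac] := eqVneq a c; last by case: ifP; lra.
    have := pn_ge0 hN (a - b); have := pn_ge0 hN (b - a).
    by rewrite eq_sym (negPf ab) subrr (pn0 hN); lra.
  - by move=> a b c; rewrite /m/= opprD addrACA subrr addr0.
exists (exist _ m mP) => x; rewrite /norm_of set_valE /= /m /= subr0 /M.
by case: ifP => _; lra.
Qed.

(** * The topology of pointwise convergence *)

Lemma continuous_eval (p : G * G) :
  continuous (fun d => (set_val d : G * G -> R) p).
Proof.
move=> d; apply: (@continuous_comp _ _ _ (set_val : invariant_metrics R G -> _)
  (fun f : {ptws (G * G)%type -> R} => f p)); first exact: initial_continuous.
exact: (@proj_continuous _ (fun _ : G * G => R) p).
Qed.

Lemma open_eval (p : G * G) (r s : R) :
  open [set d : invariant_metrics R G | r < (set_val d : G * G -> R) p < s].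
Proof.
rewrite (_ : mkset _ = (fun d => (set_val d : G * G -> R) p) @^-1` `]r, s[%classic).
  by apply: open_comp; [move=> d _; exact: continuous_eval|exact: interval_open].
by apply/seteqP; split=> d /=; rewrite in_itv/=.
Qed.

End Norm.

Lemma cvg_initial (S : choiceType) (T : topologicalType) (f : S -> T)
    (F : set_system S) (s : S) : Filter F ->
  f @ F --> f s -> F --> (s : initial_topology f).
Proof.
move=> FF fF A [_ [[B oB <-] Bs BA]].
by apply: filterS BA _; apply: fF; exact: open_nbhs_nbhs.
Qed.

(** Countability of the group makes a basic neighbourhood a finite piece of an
    exhaustion, so that a sequence suffices to reach [d]. *)
Lemma closure_of_approx (R : realType) (G : zmodType)
    (G_countable : countable [set: G])
    (U : set (invariant_metrics R G)) (d : invariant_metrics R G) :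
  (forall (E : seq G) (t : R), 0 < t -> exists2 d', U d' &
     forall x, x \in E -> `|norm_of d' x - norm_of d x| < t) ->
  closure U d.
Proof.
have [e e_surj] := exists_enumeration 0 G_countable.
move=> dU; pose t n : R := n.+1%:R^-1.
have t0 n : 0 < t n by rewrite invr_gt0.
have /choice[u uP] : forall n, exists d', U d' /\
    forall i, (i < n)%N -> `|norm_of d' (e i) - norm_of d (e i)| < t n.
  move=> n; have [d' Ud' dd'] := dU [seq e i | i <- iota 0 n] _ (t0 n).
  by exists d'; split=> // i ni; apply/dd'/map_f; rewrite mem_iota.
have ud : u @ \oo --> d.
  apply: cvg_initial; apply/cvg_sup => p; apply: cvg_initial.
  have [i pi] := e_surj (p.1 - p.2).
  suff : (set_val (u n) : G * G -> R) p @[n --> \oo] --> set_val d p by [].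
  apply/cvgrPdist_lt => s s0; near=> n.
  rewrite distrC [p]surjective_pairing !norm_ofB -pi.
  apply: (@lt_trans _ _ (t n)).
    by apply: (uP n).2; near: n; exact: nbhs_infty_gt.
  by near: n; exact: near_infty_natSinv_lt (PosNum s0).
move=> V dV; have [n /= _ nV] := ud _ dV.
by exists (u n); split; [exact: (uP n).1|exact: nV (leqnn n)].
Unshelve. all: by end_near. Qed.

(** * Generic metrics *)

(** Sublinear growth along multiples means zero asymptotic slope. Only one good
    multiple is asked for, which makes the condition open; subadditivity then
    bounds all larger multiples. *)
Definition sublinear (R : realType) (H : zmodType) (N : H -> R) : Prop :=
  forall (x : H) (t : R), 0 < t -> exists2 n, (0 < n)%N & N (x *+ n) < t *+ n.

Lemma countable_seq (T : Type) : countable [set: T] -> countable [set: seq T].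
Proof.
move=> /countable_injP[f finj]; apply/countable_injP.
exists (fun s => pickle (map f s)) => s t _ _ /(pcan_inj pickleK).
by apply: inj_map => x y; apply: finj; rewrite inE.
Qed.

Lemma countable_pair (T U : Type) :
  countable [set: T] -> countable [set: U] -> countable [set: T * U].
Proof.
move=> /countable_injP[f finj] /countable_injP[g ginj]; apply/countable_injP.
exists (fun p => pickle (f p.1, g p.2)) => -[x y] [x' y'] _ _.
move=> /(pcan_inj pickleK)[fx gy].
by congr (_, _); [apply: finj|apply: ginj]; rewrite ?inE.
Qed.

Section Generic.
Variables (R : realType) (G : zmodType).
Hypothesis G_countable : countable [set: G].
Implicit Type d : invariant_metrics R G.

(** An entry [(y, a, r, s)] of the list asks that [f y] be at distance between
    [r] and [s] from [a]. With [a = 0] this prescribes the length of [f y];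
    otherwise it prescribes where [f] sends [y]. *)
Definition realizable (c : seq (G * G * rat * rat)) :
    set (invariant_metrics R G) :=
  [set d | exists f : {additive G -> G}, forall y a r s, (y, a, r, s) \in c ->
     ratr r < (set_val d : G * G -> R) (f y, a) < ratr s].

(** The first clause is membership in the open dense set
    [realizable c `|` ~` closure (realizable c)] for every [c]. It turns a
    constraint that can be met after a small perturbation of [d] into one met
    by [d] itself. *)
Definition generic d : Prop :=
  (forall c, closure (realizable c) d -> realizable c d) /\
  sublinear (norm_of d).

Lemma open_realizable c : open (realizable c).
Proof.
rewrite (_ : realizable c = \bigcup_(f in [set: {additive G -> G}])
    \bigcap_(q in [set` c]) [set d : invariant_metrics R G |
       ratr q.1.2 < (set_val d : G * G -> R) (f q.1.1.1, q.1.1.2) < ratr q.2]).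
  apply: bigcup_open => f _; rewrite bigcap_seq.
  by apply: big_ind => [||q _]; [exact: openT|exact: openI|exact: open_eval].
apply/seteqP; split=> [d [f df]|d [f _ df]].
  by exists f => // -[[[y a] r] s] /= /df.
by exists f => y a r s /df.
Qed.

Lemma open_sublinear_at (x : G) (t : R) :
  open [set d | exists2 n, (0 < n)%N & norm_of d (x *+ n) < t *+ n].
Proof.
rewrite (_ : mkset _ = \bigcup_(n in [set n | (0 < n)%N])
  [set d | -1 < (set_val d : G * G -> R) (x *+ n, 0) < t *+ n]).
  by apply: bigcup_open => n _; exact: open_eval.
apply/seteqP; split=> [d [n n0 dn]|d [n n0 /= /andP[_ dn]]]; exists n => //=.
by rewrite dn andbT (lt_le_trans (ltrN10 R))// im_ge0.
Qed.

Lemma pseudonorm_min (N : G -> R) (C : R) : pseudonorm N -> 0 <= C ->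
  pseudonorm (fun x => Num.min (N x) C).
Proof.
move=> hN C0; split=> [|x|x y]; first by rewrite (pn0 hN) min_l.
  by rewrite (pnN hN).
have := pnD hN x y; have := pn_ge0 hN x; have := pn_ge0 hN y.
rewrite !minEle; case: ifP; case: ifP; case: ifP; rewrite ?ltNge -?ltNge; lra.
Qed.

(** Truncating the length of [d] at a level [C] above its values on a finite
    set does not change it there, and a bounded length has slope zero. *)
Lemma dense_sublinear_at (x : G) (t : R) : 0 < t ->
  dense [set d | exists2 n, (0 < n)%N & norm_of d (x *+ n) < t *+ n].
Proof.
move=> t0 V [d Vd] oV.
have [d' [? ?]] : [set d | exists2 n, (0 < n)%N & norm_of d (x *+ n) < t *+ n]
    `&` V !=set0; last by exists d'.
apply: (closure_of_approx G_countable _ (open_nbhs_nbhs (conj oV Vd))).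
move=> E s s0; have hN := pseudonorm_norm_of d.
pose C := \sum_(y <- E) norm_of d y.
have C0 : 0 <= C by apply: sumr_ge0 => y _; exact: pn_ge0.
have s20 : 0 < s / 2 by lra.
have [d' dd'] := invariant_metric_near (pseudonorm_min hN C0) s20.
exists d'.
  have [n nC] : exists n, (C + s / 2) / t < n%:R.
    by exists (Num.truncn ((C + s / 2) / t)).+1; rewrite truncnS_gt.
  exists n; first by rewrite -(ltr_nat R) (le_lt_trans _ nC)// divr_ge0; lra.
  have /andP[_] := dd' (x *+ n); move/le_lt_trans; apply.
  rewrite -[ltRHS]mulr_natr [ltRHS]mulrC -ltr_pdivrMr//; apply: le_lt_trans nC.
  by rewrite ler_pM2r ?invr_gt0// lerD2r ge_min lexx orbT.
move=> y yE; have := dd' y; rewrite min_l => [|]; first by rewrite ltr_norml; lra.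
rewrite /C (big_rem y)//= lerDl; apply: sumr_ge0 => z _; exact: pn_ge0.
Qed.

Lemma comeager_generic : comeager [set d | generic d].
Proof.
pose A := [set d | forall c, (realizable c `|` ~` closure (realizable c)) d].
pose B := [set d : invariant_metrics R G | forall p : G * nat, exists2 n, (0 < n)%N &
            norm_of d (p.1 *+ n) < p.2.+1%:R^-1 *+ n].
have [S SG SAB] : comeager (A `&` B).
  apply: comeagerI; apply: comeager_forall.
  - by do ![apply: countable_seq || apply: countable_pair || exact: countableP].
  - by move=> c; exact/open_decided/open_realizable.
  - by move=> c; exact: dense_decided.
  - by apply: countable_pair.
  - by move=> p; exact: open_sublinear_at.
  - by move=> p; apply: dense_sublinear_at; rewrite invr_gt0.
exists S => // d /SAB[Ad Bd]; split=> [c cd|x t t0].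
  by have [//|] := Ad c.
have [N _ HN] := near_infty_natSinv_lt (PosNum t0).
have [n n0 nd] := Bd (x, N); exists n => //; apply: lt_trans nd _.
by rewrite ltr_pMn2r// HN/=.
Qed.

End Generic.

(** * Relaxing a length by a set of relations *)

Section Relax.
Variables (R : realType) (H : zmodType) (M : H -> R) (P : {pred H}) (t : R).
Hypotheses (hM : pseudonorm M) (t_ge0 : 0 <= t).
Hypothesis P_opp : forall z, z \in P -> - z \in P.

(** This is the largest pseudonorm below [M] whose value on [P] is at most [t]. *)
Definition relax (z : H) : R :=
  inf [set r | exists2 s : seq H, {subset s <= P} &
               r = M (z - \sum_(p <- s) p) + t *+ size s].

Lemma relax_le (s : seq H) (sP : {subset s <= P}) (z : H) :
  relax z <= M (z - \sum_(p <- s) p) + t *+ size s.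
Proof.
apply: ge_inf; last by exists s.
by exists 0 => _ [u _ ->]; rewrite addr_ge0 ?mulrn_wge0 ?(pn_ge0 hM).
Qed.

Lemma relax_ge (z : H) (c : R) :
  (forall s, {subset s <= P} -> c <= M (z - \sum_(p <- s) p) + t *+ size s) ->
  c <= relax z.
Proof.
move=> cz; apply: lb_le_inf => [|_ [s sP ->]]; last exact: cz.
by exists (M (z - \sum_(p <- [::]) p) + t *+ 0), [::].
Qed.

Lemma relax_le_id (z : H) : relax z <= M z.
Proof.
have /relax_le/(_ z) : {subset [::] <= P} by [].
by rewrite big_nil subr0 addr0.
Qed.

Lemma relax_le_mem (z : H) : z \in P -> relax z <= t.
Proof.
move=> zP; have /relax_le/(_ z) : {subset [:: z] <= P} by move=> x /[!inE]/eqP->.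
by rewrite big_seq1 subrr (pn0 hM) add0r.
Qed.

Lemma pseudonorm_relax : pseudonorm relax.
Proof.
have relaxN x : relax (- x) <= relax x.
  apply: relax_ge => s sP; have sP' : {subset map -%R s <= P}.
    by move=> _ /mapP[z /sP zP ->]; exact: P_opp.
  apply: le_trans (relax_le sP' _) _.
  by rewrite big_map sumrN size_map -opprD (pnN hM).
split=> [|x|x y].
- apply/eqP; rewrite eq_le (le_trans (relax_le_id _)) ?(pn0 hM)//=.
  by apply: relax_ge => s _; rewrite addr_ge0 ?mulrn_wge0 ?(pn_ge0 hM).
- by apply/eqP; rewrite eq_le relaxN -{1}[x]opprK relaxN.
- rewrite -lerBlDl; apply: relax_ge => s sP; rewrite lerBlDl -lerBlDr.
  apply: relax_ge => u uP; rewrite lerBlDr.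
  have suP : {subset u ++ s <= P} by move=> z /[!mem_cat]/orP[/uP|/sP].
  apply: le_trans (relax_le suP _) _.
  rewrite big_cat/= opprD addrACA size_cat mulrnDr [leRHS]addrACA lerD2r.
  exact: pnD.
Qed.

End Relax.

(** * Room for a free copy of the group *)

Lemma exists_additive (U V : zmodType) (h : U -> V) :
  (forall x y, h (x - y) = h x - h y) ->
  exists h' : {additive U -> V}, forall x, h' x = h x.
Proof.
move=> hB; pose A := GRing.isZmodMorphism.Build U V h hB.
by exists (HB.pack_for {additive U -> V} h A).
Qed.

Lemma exists_common_bound (T : eqType) (E : seq T) (Q : T -> nat -> Prop) :
  (forall x m n, (m <= n)%N -> Q x m -> Q x n) -> (forall x, exists n, Q x n) ->
  exists n, forall x, x \in E -> Q x n.
Proof.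
move=> Qmon Qex; elim: E => [|x E [n En]]; first by exists 0%N.
have [m Qm] := Qex x; exists (maxn m n) => y /[!inE]/orP[/eqP->|/En].
  by apply: (Qmon _ _ _ _ Qm); exact: leq_maxl.
by apply: Qmon; exact: leq_maxr.
Qed.

Section Absorption.
Variable G : zmodType.
Hypothesis G_sum : group_isomorphic G (direct_sum G).

(** Elements of [E] involve only the first [n] summands of the direct sum, so
    the summand of index [n] is a fresh copy of [G]: [p] truncates to the first
    [n] summands, [q] reads off the summand [n], and [j] embeds [G] there. Thus
    [x |-> (p x, q x)] sends [E] to the first factor of [G * G] and the image
    of [j] isomorphically to the second. *)
Lemma absorption (E : seq G) : exists p q j : {additive G -> G},
  [/\ forall x, x \in E -> p x = x, forall x, x \in E -> q x = 0,
      forall y, p (j y) = 0 & forall y, q (j y) = y].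
Proof.
have [f [g fK gK]] := G_sum.
have gB u v : g (u - v) = g u - g v.
  by apply: (can_inj fK); rewrite raddfB !gK.
have [n En] : exists n, forall x, x \in E ->
    forall m, (n <= m)%N -> val (f x) m = 0.
  apply: exists_common_bound => [x m n mn xm k nk|x].
    by apply: xm; exact: leq_trans nk.
  have /asboolP/finite_seqP[s sE] := valP (f x).
  exists (\max_(i <- s) i).+1 => m; apply: contraTeq => fm.
  have ms : m \in s by have : [set` s] m by rewrite -sE.
  by rewrite -leqNgt; exact: leq_bigmax_seq.
have truncP (u : direct_sum G) :
    (fun m => if (m < n)%N then val u m else 0) \in @finitely_supported G.
  apply/asboolP; apply: sub_finite_set (finite_II n) => m /=.
  by case: ifP; rewrite ?eqxx.
have singleP (y : G) :
    (fun m => if m == n then y else 0) \in @finitely_supported G.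
  apply/asboolP; apply: sub_finite_set (finite_set1 n) => m /=.
  by case: (m =P n) => [->|]; rewrite ?eqxx.
pose trunc u : direct_sum G := 
  exist (fun h : nat -> G => h \in @finitely_supported G) _ (truncP u).
pose single y : direct_sum G := 
  exist (fun h : nat -> G => h \in @finitely_supported G) _ (singleP y).
have [p pE] : exists p : {additive G -> G}, forall x, p x = g (trunc (f x)).
  apply: exists_additive => x y; rewrite -gB; congr g; apply: val_inj.
  apply/funext => m; rewrite raddfB /=.
  rewrite -[RHS]/((if (m < n)%N then val (f x) m else 0) -
                  (if (m < n)%N then val (f y) m else 0)).
  by case: ifP => //; rewrite subr0.
have [q qE] : exists q : {additive G -> G}, forall x, q x = val (f x) n.
  by apply: exists_additive => x y; rewrite raddfB.
have [j jE] : exists j : {additive G -> G}, forall x, j x = g (single x).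
  apply: exists_additive => x y; rewrite -gB; congr g; apply: val_inj.
  apply/funext => m /=.
  rewrite -[RHS]/((if m == n then x else 0) - (if m == n then y else 0)).
  by case: ifP => //; rewrite subr0.
exists p, q, j; split=> [x xE|x xE|y|y].
- rewrite pE -[RHS]fK; congr g; apply/val_inj/funext => m /=.
  by case: ltnP => // nm; rewrite En.
- by rewrite qE En.
- rewrite pE jE gK -[RHS]fK raddf0; congr g; apply/val_inj/funext => m /=.
  by case: ltngtP.
- by rewrite qE jE gK/= eqxx.
Qed.

End Absorption.

(** * Extending almost isometries of a generic metric *)

(** The error is allowed to grow with the number of summands: this is exactly
    what keeps a gluing along [f] at cost [t] from shortening either side
    ([amalgam_left], [amalgam_right]). *)
Definition almost_isometric (R : realType) (G : zmodType) (N N' : G -> R)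
    (f : {additive G -> G}) (F : seq G) (t : R) : Prop :=
  forall s : seq G, {subset s <= F} ->
    `|N' (f (\sum_(x <- s) x)) - N (\sum_(x <- s) x)| <= t *+ size s.

Section Extension.
Variables (R : realType) (G : zmodType).
Hypothesis G_countable : countable [set: G].
Hypothesis G_sum : group_isomorphic G (direct_sum G).

Section Amalgam.
Variables (N N' : G -> R) (f : {additive G -> G}) (F : seq G) (t : R).
Hypotheses (hN : pseudonorm N) (hN' : pseudonorm N') (t_gt0 : 0 < t).
Hypothesis F_opp : forall x, x \in F -> - x \in F.
Hypothesis f_isom : almost_isometric N N' f F t.

Definition sum_length (z : G * G) : R := N z.1 + N' z.2.
(** Relaxing along [(x, - f x)] identifies [x] in the first factor with [f x]
    in the second, up to [t]. *)
Definition anti_graph : {pred G * G} :=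
  [pred z | (z.1 \in F) && (z.2 == - f z.1)].
Definition amalgam : G * G -> R := relax sum_length anti_graph t.

Lemma pseudonorm_sum_length : pseudonorm sum_length.
Proof.
split=> [|x|x y]; rewrite /sum_length ?(pn0 hN) ?(pn0 hN') ?addr0//=.
  by rewrite (pnN hN) (pnN hN').
by have := pnD hN x.1 y.1; have := pnD hN' x.2 y.2; lra.
Qed.

Lemma anti_graph_opp z : z \in anti_graph -> - z \in anti_graph.
Proof.
case: z => x y /andP[/= xF /eqP->]; apply/andP; split; first exact: F_opp.
by rewrite /= raddfN.
Qed.

Lemma pseudonorm_amalgam : pseudonorm amalgam.
Proof.
apply: pseudonorm_relax; [exact: pseudonorm_sum_length|exact: ltW|].
exact: anti_graph_opp.
Qed.

Lemma sum_anti_graph (s : seq (G * G)) : {subset s <= anti_graph} ->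
  exists u, [/\ {subset u <= F}, size u = size s &
    \sum_(p <- s) p = (\sum_(x <- u) x, - f (\sum_(x <- u) x))].
Proof.
elim: s => [|[x y] s IHs] sP.
  by exists [::]; split=> //; rewrite !big_nil raddf0 oppr0.
have [|u [uF su uE]] := IHs; first by move=> z zs; apply: sP; rewrite inE zs orbT.
have /andP[/= xF /eqP->] := sP _ (mem_head _ _).
exists (x :: u); split=> [z /[!inE]/orP[/eqP->//|/uF//]||]; first by rewrite /= su.
by rewrite !big_cons uE raddfD opprD.
Qed.

(** A shortcut through the second factor moves [x] by some [v], a sum of [n]
    elements of [F]; it costs [N' (f v) + n t], which is at least [N v]. *)
Lemma amalgam_left x : amalgam (x, 0) = N x.
Proof.
apply/eqP; rewrite eq_le; apply/andP; split.
  apply: (le_trans (relax_le_id _ pseudonorm_sum_length (ltW t_gt0) _)).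
  by rewrite /sum_length/= (pn0 hN') addr0.
apply: relax_ge => s /sum_anti_graph[u [uF <- ->]].
rewrite /sum_length/= sub0r opprK; set v := \sum_(x <- u) x.
have := f_isom uF; rewrite -/v ler_norml => /andP[fv _].
by have := pnD hN (x - v) v; rewrite subrK; lra.
Qed.

Lemma amalgam_right y : amalgam (0, y) = N' y.
Proof.
apply/eqP; rewrite eq_le; apply/andP; split.
  apply: (le_trans (relax_le_id _ pseudonorm_sum_length (ltW t_gt0) _)).
  by rewrite /sum_length/= (pn0 hN) add0r.
apply: relax_ge => s /sum_anti_graph[u [uF <- ->]].
rewrite /sum_length/= sub0r opprK; set v := \sum_(x <- u) x.
have := f_isom uF; rewrite -/v ler_norml => /andP[_ fv].
by have := pnB hN' (y + f v) (f v); rewrite addrK (pnN hN); lra.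
Qed.

Lemma amalgam_graph x : x \in F -> amalgam (- x, f x) <= t.
Proof.
move=> xF; apply: relax_le_mem; [exact: pseudonorm_sum_length|exact: ltW|].
by apply/andP; rewrite /= F_opp// raddfN opprK.
Qed.

End Amalgam.

(** The constraint list below is realized by metrics near [d] obtained by
    pulling the glued length back to [G] along the two projections given by
    [absorption]; the embedding [j] of the fresh copy is the required
    endomorphism for such a metric. *)
Lemma generic_extension (d : invariant_metrics R G) (N' : G -> R)
    (f : {additive G -> G}) (F T : seq G) (t r : R) :
  generic d -> pseudonorm N' -> 0 < t -> 0 < r ->
  (forall x, x \in F -> - x \in F) ->
  almost_isometric (norm_of d) N' f F t ->
  exists g : {additive G -> G},
    (forall x, x \in F -> norm_of d (g (f x) - x) < t *+ 2) /\
    (forall y, y \in T -> `|norm_of d (g y) - N' y| < r).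
Proof.
move=> [d_gen _] hN' t0 r0 F_opp f_isom; have hN := pseudonorm_norm_of d.
have between (a b : R) : a < b -> exists q : rat, a < ratr q < b.
  by move=> /rat_in_itvoo[q]; rewrite in_itv/=; exists q.
(* The bounds leave a margin of [t / 2], respectively [r / 2], which absorbs
   the perturbation [u] that makes the glued length definite. *)
have [q qP] : exists q : rat, t + t / 2 < ratr q < t *+ 2.
  by apply: between; lra.
have /choice[lo loP] y : exists q : rat, N' y - r < ratr q < N' y.
  by apply: between; lra.
have /choice[hi hiP] y : exists q : rat, N' y + r / 2 < ratr q < N' y + r.
  by apply: between; lra.
(* The lower bound [-1] is void since distances are nonnegative. *)
pose c := [seq (f x, x, -1 : rat, q) | x <- F] ++
          [seq (y, 0, lo y, hi y) | y <- T].
have [g gP] : realizable c d.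
  apply: d_gen; apply: closure_of_approx => // E s s0.
  have [p1 [p2 [j [p1E p2E p1j p2j]]]] := absorption G_sum (E ++ F).
  pose K x := amalgam (norm_of d) N' f F t (p1 x, p2 x).
  have hK : pseudonorm K.
    have hA := pseudonorm_amalgam f hN hN' t0 F_opp.
    split=> [|x|x y]; rewrite /K; first by rewrite !raddf0 (pn0 hA).
      by rewrite !raddfN; exact: (pnN hA (p1 x, p2 x)).
    by rewrite !raddfD; exact: (pnD hA (p1 x, p2 x) (p1 y, p2 y)).
  pose u := Num.min (s / 2) (Num.min (r / 2) (t / 2)).
  have u0 : 0 < u by rewrite !lt_min; apply/and3P; split; lra.
  have [us ur ut] : [/\ u <= s / 2, u <= r / 2 & u <= t / 2].
    by rewrite !ge_min !lexx !orbT.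
  have [d0 d0P] := invariant_metric_near hK u0; exists d0; last first.
    move=> x xE; have := d0P x; rewrite {1 2}/K p1E ?p2E ?mem_cat ?xE//.
    by rewrite amalgam_left// ltr_norml; lra.
  exists j => y a r1 r2; rewrite mem_cat => /orP[] /mapP[x xT [-> -> -> ->]].
    rewrite norm_ofB rmorphN1 (lt_le_trans (ltrN10 R))/=;
      last exact/pn_ge0/pseudonorm_norm_of.
    have := d0P (j (f x) - x).
    rewrite {1 2}/K !raddfB p1j p2j p1E ?p2E ?mem_cat ?xT ?orbT// sub0r subr0.
    by have := amalgam_graph f hN hN' t0 F_opp xT; lra.
  rewrite norm_ofB subr0; have := d0P (j x); rewrite {1 2}/K p1j p2j.
  by rewrite amalgam_right//; have := loP x; have := hiP x; lra.
exists g; split=> [x xF|y yT].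
  have xc : (f x, x, -1 : rat, q) \in c.
    by rewrite mem_cat (map_f (fun x => (f x, x, -1 : rat, q)) xF).
  have /andP[_] := gP _ _ _ _ xc; rewrite norm_ofB => /lt_trans; apply.
  by case/andP: qP.
have yc : (y, 0, lo y, hi y) \in c.
  by rewrite mem_cat (map_f (fun y => (y, 0, lo y, hi y)) yT) orbT.
have := gP _ _ _ _ yc; rewrite norm_ofB subr0.
by have := loP y; have := hiP y; rewrite ltr_norml; lra.
Qed.

End Extension.

(** * Finite control of sublinear lengths *)

Lemma big_seq_count (V : nmodType) (T : eqType) (A s : seq T) (F : T -> V) :
  {subset s <= A} ->
  \sum_(x <- s) F x = \sum_(a <- undup A) F a *+ count_mem a s.
Proof.
elim: s => [|x s IHs] sA; first by rewrite big_nil big1.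
rewrite big_cons IHs => [|y ys]; last by apply: sA; rewrite inE ys orbT.
have xA : x \in undup A by rewrite mem_undup sA ?mem_head.
under [RHS]eq_bigr do rewrite /= mulrnDr; rewrite big_split/=; congr (_ + _).
rewrite (bigD1_seq x)//= ?undup_uniq// eqxx mulr1n big1 ?addr0// => a.
by rewrite eq_sym => /negPf->.
Qed.

(** Unlike the sums of exactly [n] elements, these form a set that contains all
    shorter sums, since every stage includes [0]. *)
Fixpoint sums_upto (G : zmodType) (A : seq G) (n : nat) : seq G :=
  if n is m.+1 then
    0 :: [seq x + y | x <- A, y <- sums_upto A m]
  else [:: 0].

Lemma mem_sums_upto (G : zmodType) (A s : seq G) (n : nat) :
  {subset s <= A} -> (size s <= n)%N -> \sum_(x <- s) x \in sums_upto A n.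
Proof.
elim: n s => [|n IHn] [|x s]//= sA sn; rewrite ?big_nil ?inE ?eqxx//.
rewrite big_cons allpairs_f ?orbT//; first by rewrite sA ?mem_head.
by apply: IHn => // y ys; apply: sA; rewrite inE ys orbT.
Qed.

Section Control.
Variables (R : realType) (G : zmodType).

(** Euclidean division of [m] by [n], the remainder being less than [n]. *)
Lemma pn_mulrn_slope (N : G -> R) (x : G) (n m : nat) (c t : R) :
  pseudonorm N -> (0 < n)%N -> 0 <= t -> N x <= c -> N (x *+ n) <= t *+ n ->
  N (x *+ m) <= c *+ n + t *+ m.
Proof.
move=> hN n0 t0 xc xt; have c0 : 0 <= c := le_trans (pn_ge0 hN x) xc.
rewrite {1}(divn_eq m n) addrC mulrnDr mulnC mulrnA.
apply: le_trans (pnD hN _ _) _; apply: lerD.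
  apply: le_trans (pn_mulrn hN _ _) _; apply: le_trans (ler_wMn2r _ xt) _.
  by rewrite -mulrnA ler_wpMn2l// mulnC leq_trunc_div.
apply: le_trans (pn_mulrn hN _ _) _; apply: le_trans (ler_wMn2r _ xc) _.
by rewrite ler_wpMn2l// ltnW// ltn_mod.
Qed.

(** By sublinearity some multiple of each [a] in [A] has slope below [t / 4].
    Estimates of [N] at [a] and at this multiple give both lengths the same
    bound [B + n t / 2] on sums of [n] elements of [A]. Once [n] is so large
    that [B <= n t / 2], both values lie between [0] and [n t]; the finitely
    many shorter sums are put into [T]. *)
Lemma sublinear_control (N0 : G -> R) (A : seq G) (t : R) :
  pseudonorm N0 -> sublinear N0 -> 0 < t ->
  exists T : seq G, forall N : G -> R, pseudonorm N ->
    (forall x, x \in T -> `|N x - N0 x| < t / 4) ->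
    forall s : seq G, {subset s <= A} ->
      `|N (\sum_(x <- s) x) - N0 (\sum_(x <- s) x)| <= t *+ size s.
Proof.
move=> hN0 N0sub t0; have t40 : 0 < t / 4 by lra.
have /choice[n nP] : forall a, exists n, (0 < n)%N /\
    N0 (a *+ n) < t / 4 *+ n by move=> a; have [n] := N0sub a _ t40; exists n.
pose B := \sum_(a <- undup A) (N0 a + t / 4) *+ n a.
have slope (N : G -> R) : pseudonorm N ->
    (forall a, a \in A -> N a <= N0 a + t / 4) ->
    (forall a, a \in A -> N (a *+ n a) <= t / 2 *+ n a) ->
    forall s, {subset s <= A} -> N (\sum_(x <- s) x) <= B + t / 2 *+ size s.
  move=> hN Na Nna s sA; rewrite (big_seq_count id sA).
  have -> : t / 2 *+ size s = \sum_(a <- undup A) t / 2 *+ count_mem a s.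
    rewrite -(big_seq_count (fun=> t / 2) sA) big_const_seq.
    by rewrite count_predT iter_addr_0.
  rewrite -big_split/=; apply: le_trans (pn_sum hN _ _) _.
  rewrite big_seq [leRHS]big_seq; apply: ler_sum => a; rewrite mem_undup => aA.
  by apply: pn_mulrn_slope; rewrite ?Na ?Nna ?(nP a).1//; lra.
have [L BL] : exists L, B / (t / 2) < L%:R.
  by exists (Num.truncn (B / (t / 2))).+1; rewrite truncnS_gt.
exists (A ++ [seq a *+ n a | a <- A] ++ sums_upto A L) => N hN NT s sA.
have [sL|Ls] := leqP (size s) L.
  have [->|s0] := eqVneq s [::].
    by rewrite big_nil (pn0 hN) (pn0 hN0) subrr normr0 mulr0n.
  apply: ltW; apply: (@lt_le_trans _ _ (t / 4)).
    by apply: NT; rewrite !mem_cat mem_sums_upto ?orbT.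
  apply: (@le_trans _ _ t); first lra.
  by rewrite -[leLHS]mulr1n ler_pMn2l// lt0n size_eq0.
have Bs : B <= t / 2 *+ size s.
  rewrite -[leRHS]mulr_natr [leRHS]mulrC -ler_pdivrMr ?ltW//; last lra.
  by rewrite (lt_le_trans BL)// ler_nat ltnW.
have ts : t *+ size s = t / 2 *+ size s + t / 2 *+ size s.
  by rewrite -mulrnDl -splitr.
have N0le : N0 (\sum_(x <- s) x) <= B + t / 2 *+ size s.
  apply: slope => // a aA; first lra.
  by apply: le_trans (ltW (nP a).2) _; apply: ler_wMn2r; lra.
have Nle : N (\sum_(x <- s) x) <= B + t / 2 *+ size s.
  apply: slope => // a aA.
    by have := NT a; rewrite mem_cat aA => /(_ isT); rewrite ltr_norml; lra.
  have := NT (a *+ n a); rewrite !mem_cat.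
  rewrite (map_f (fun a => a *+ n a) aA) orbT => /(_ isT).
  have := (nP a).2; have : t / 4 <= t / 4 *+ n a.
    by rewrite -[leLHS]mulr1n ler_pMn2l// (nP a).1.
  have -> : t / 2 *+ n a = t / 4 *+ n a + t / 4 *+ n a.
    by rewrite -mulrnDl; congr (_ *+ _); lra.
  by rewrite ltr_norml; lra.
have := pn_ge0 hN0 (\sum_(x <- s) x); have := pn_ge0 hN (\sum_(x <- s) x).
by rewrite ler_norml ts; lra.
Qed.

End Control.

(** * Limits of almost isometries *)

Section Weight.
Variable R : realType.

Definition weight (n : nat) : R := (2 ^ n)%:R^-1.

Lemma weight_gt0 n : 0 < weight n.
Proof. by rewrite invr_gt0 ltr0n expn_gt0. Qed.

Lemma weightS n : weight n = weight n.+1 + weight n.+1.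
Proof.
rewrite /weight expnS natrM invfM; have := weight_gt0 n; rewrite /weight; lra.
Qed.

Lemma weight_le m n : (m <= n)%N -> weight n <= weight m.
Proof.
by move=> mn; rewrite lef_pV2 ?posrE ?ltr0n ?expn_gt0// ler_nat leq_exp2l.
Qed.

Lemma weight_small (t : R) : 0 < t ->
  exists N, forall n, (N <= n)%N -> weight n < t.
Proof.
move=> t0; have [N _ HN] := near_infty_natSinv_lt (PosNum t0).
exists N => n Nn; apply: le_lt_trans (weight_le Nn) _.
apply: le_lt_trans (HN N _) => //=.
by rewrite lef_pV2 ?posrE ?ltr0n ?expn_gt0// ler_nat ltn_expl.
Qed.

End Weight.

Section CompletionNorm.
Variables (R : realType) (G : zmodType) (d : invariant_metrics R G).

Lemma mdist_to_completion (a b : G) :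
  mdist (to_completion d a) (to_completion d b) = norm_of d (a - b).
Proof. by rewrite to_completion_isometry norm_ofB. Qed.

Lemma mdistD (x y x' y' : completion d) :
  mdist (x + y) (x' + y') <= mdist x x' + mdist y y'.
Proof.
apply: le_trans (metric_triangle _ (x' + y) _) _.
by rewrite -completion_invariant ![x' + _]addrC -completion_invariant.
Qed.

Lemma to_completion_dense (x : completion d) (t : R) : 0 < t ->
  exists a, mdist (to_completion d a) x < t.
Proof.
move=> t0; have [N /(_ N (leqnn N))] := to_completion_approx (repr x) t0.
by rewrite reprK; exists (val (repr x) N).
Qed.

End CompletionNorm.

Lemma exists_argmin (R : realType) (T : eqType) (F : seq T) (h : T -> R) (x0 : T) :
  x0 \in F -> exists2 a, a \in F & forall b, b \in F -> h a <= h b.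
Proof.
elim: F x0 => // x [_ _ _|y F IHF _ _].
  by exists x; rewrite ?mem_head// => b /[!inE]/eqP->.
have [a aF amin] := IHF y (mem_head _ _).
have [xa|ax] := leP (h x) (h a).
  exists x; rewrite ?mem_head// => b; rewrite in_cons => /predU1P[->//|bF].
  exact: le_trans xa (amin b bF).
exists a => [|b]; first by rewrite in_cons aF orbT.
by rewrite in_cons => /predU1P[->|bF]; [exact: ltW|exact: amin].
Qed.

Section Limit.
Variables (R : realType) (G : zmodType) (d d' : invariant_metrics R G).
Variables (f : nat -> {additive G -> G}) (F : nat -> seq G).
Hypothesis F0 : forall n, 0 \in F n.
Hypothesis F_opp : forall n x, x \in F n -> - x \in F n.
Hypothesis F_le : forall n, {subset F n <= F n.+1}.
Hypothesis F_exhaust : forall x, exists n, x \in F n.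
Hypothesis f_isom :
  forall n, almost_isometric (norm_of d) (norm_of d') (f n) (F n) (weight R n).
Hypothesis f_step :
  forall n a, a \in F n -> norm_of d' (f n.+1 a - f n a) <= weight R n *+ 6.

Local Notation i := (to_completion d).
Local Notation i' := (to_completion d').

(** The limit of the [f n] is described on the completion by its graph: a point
    [x] is approached from the sets [F n] where [f n] is controlled. With
    [weight R n] tending to [0], this relation is an isometric and additive
    partial function, and it is visibly compatible with taking inverses, so
    that bijectivity comes from its totality in both directions. *)
Definition limit_graph (x : completion d) (y : completion d') : Prop :=
  forall t : R, 0 < t -> exists N, forall n, (N <= n)%N ->
    exists2 a, a \in F n & mdist (i a) x < t /\ mdist (i' (f n a)) y < t.

Lemma F_mono m n : (m <= n)%N -> {subset F m <= F n}.
Proof.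
by move=> /subnKC <-; elim: (n - m)%N => [|k IHk] x xF;
  rewrite ?addn0// addnS; exact/F_le/IHk.
Qed.

(** The steps [6 * 2 ^- k] for [k >= n] sum up to [12 * 2 ^- n]. *)
Lemma f_close m n a : (n <= m)%N -> a \in F n ->
  norm_of d' (f m a - f n a) <= weight R n *+ 12.
Proof.
have hN := pseudonorm_norm_of d'.
move=> nm aF; apply: (@le_trans _ _ (weight R n *+ 12 - weight R m *+ 12));
  last by rewrite lerBlDr lerDl mulrn_wge0// ltW// weight_gt0.
move: nm => /subnKC <-; elim: (m - n)%N => [|k IHk].
  by rewrite addn0 !subrr (pn0 hN).
rewrite addnS; apply: le_trans (pn_tri hN (f (n + k)%N a) _ _) _.
have := @f_step (n + k)%N a (F_mono (leq_addr _ _) aF).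
by have := weightS R (n + k); lra.
Qed.

Lemma f_diff n a b : a \in F n -> b \in F n ->
  `|norm_of d' (f n (a - b)) - norm_of d (a - b)| <= weight R n *+ 2.
Proof.
move=> aF bF; have := @f_isom n [:: a; - b]; rewrite !big_cons big_nil addr0.
by apply=> x /[!inE]/orP[/eqP->//|/eqP->]; exact: F_opp.
Qed.

(** Take for [a n] a point of [F n] closest to [x]. These converge to [x] as
    the [F n] exhaust a dense subgroup, and [f n (a n)] is a Cauchy sequence
    because [f m] is almost isometric and almost equal to [f n] on [F n]. *)
Lemma limit_graph_total x : exists y, limit_graph x y.
Proof.
have /choice[a aP] n : exists a, a \in F n /\
    forall b, b \in F n -> mdist (i a) x <= mdist (i b) x.
  have [a aF amin] := exists_argmin (fun a => mdist (i a) x) (F0 n).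
  by exists a.
have ax t : 0 < t -> exists N, forall n, (N <= n)%N -> mdist (i (a n)) x < t.
  move=> t0; have [b bx] := to_completion_dense x t0.
  have [N bF] := F_exhaust b; exists N => n Nn.
  by apply: le_lt_trans bx; apply: (aP n).2; exact: F_mono bF.
pose v n := f n (a n).
have hN := pseudonorm_norm_of d; have hN' := pseudonorm_norm_of d'.
have vc : v \in cauchy_seq d'.
  apply/asboolP => t t0; have t'0 : 0 < t / 64 by lra.
  have [N1 aN1] := ax _ t'0; have [N2 wN2] := weight_small t'0.
  pose N := maxn N1 N2.
  have vN m : (N <= m)%N -> norm_of d' (v m - v N) < t / 2.
    move=> Nm; rewrite /v -[X in norm_of _ X](subrKA (f m (a N))).
    have aNm : a N \in F m by apply: (F_mono Nm); exact: (aP N).1.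
    have := f_close Nm (aP N).1; have := f_diff (aP m).1 aNm; rewrite ler_norml.
    have := pnD hN' (f m (a m) - f m (a N)) (f m (a N) - f N (a N)).
    rewrite -raddfB -mdist_to_completion.
    have := metric_triangle (i (a m)) x (i (a N)).
    have := aN1 N (leq_maxl _ _); have := aN1 m (leq_trans (leq_maxl _ _) Nm).
    rewrite [mdist x _]metric_sym.
    have := wN2 N (leq_maxr _ _); have := wN2 m (leq_trans (leq_maxr _ _) Nm).
    lra.
  exists N => m n Nm Nn; rewrite norm_ofB.
  have := pn_tri hN' (v N) (v m) (v n); rewrite (pn_distC hN' (v N)).
  by have := vN m Nm; have := vN n Nn; lra.
pose u : cauchySeq d' := exist _ v vc.
exists (\pi_(completion d') u) => t t0.
have [N1 aN1] := ax _ t0; have [N2 uN2] := to_completion_approx u t0.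
exists (maxn N1 N2) => n; rewrite geq_max => /andP[n1 n2].
by exists (a n); [exact: (aP n).1|split; [exact: aN1|exact: uN2]].
Qed.

Lemma limit_graph_isometry x y x' y' :
  limit_graph x y -> limit_graph x' y' -> mdist y y' = mdist x x'.
Proof.
move=> xy xy'; apply/eqP; rewrite -subr_eq0 -normr_le0; apply/ler_addgt0Pl => t t0.
rewrite addr0; have t'0 : 0 < t / 16 by lra.
have [N1 P1] := xy _ t'0; have [N2 P2] := xy' _ t'0.
have [N3 P3] := weight_small t'0; pose n := maxn N1 (maxn N2 N3).
have [|a aF [ax ay]] := P1 n; first by rewrite leq_maxl.
have [|a' aF' [ax' ay']] := P2 n; first by rewrite leq_max leq_maxl orbT.
have := P3 n; rewrite leq_max leq_maxr orbT => /(_ isT) wn.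
have := f_diff aF aF'; rewrite raddfB -!mdist_to_completion !ler_norml.
have := metric_triangle y (i' (f n a)) y'.
have := metric_triangle (i' (f n a)) (i' (f n a')) y'.
have := metric_triangle (i' (f n a)) y (i' (f n a')).
have := metric_triangle y y' (i' (f n a')).
have := metric_triangle x (i a) x'.
have := metric_triangle (i a) (i a') x'.
have := metric_triangle (i a) x (i a').
have := metric_triangle x x' (i a').
rewrite [mdist y (i' (f n a))]metric_sym [mdist y' (i' (f n a'))]metric_sym.
rewrite [mdist x (i a)]metric_sym [mdist x' (i a')]metric_sym.
lra.
Qed.

(** [f n] hardly changes the length of the three-term sum [b - a - a'], which is
    small when [a], [a'] and [b] approach [x], [x'] and [x + x']. *)
Lemma limit_graph_add x y x' y' z : limit_graph x y -> limit_graph x' y' ->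
  limit_graph (x + x') z -> z = y + y'.
Proof.
move=> xy xy' xz; apply: mdist_positivity; apply/eqP.
rewrite eq_le mdist_ge0 andbT; apply/ler_addgt0Pl => t t0.
rewrite addr0; have t'0 : 0 < t / 16 by lra.
have [N1 P1] := xy _ t'0; have [N2 P2] := xy' _ t'0.
have [N3 P3] := xz _ t'0; have [N4 P4] := weight_small t'0.
pose n := maxn (maxn N1 N2) (maxn N3 N4).
have [|a aF [ax ay]] := P1 n; first by rewrite leq_max leq_maxl.
have [|a' aF' [ax' ay']] := P2 n; first by rewrite leq_max leq_maxr.
have [|b bF [bx bz]] := P3 n; first by rewrite leq_max leq_maxl orbT.
have := P4 n; rewrite leq_max leq_maxr orbT => /(_ isT) wn.
have := @f_isom n [:: b; - a; - a']; rewrite !big_cons big_nil addr0.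
rewrite -(opprD a a') raddfB raddfD -!mdist_to_completion.
rewrite !to_completionD ler_norml/=.
have gF : {subset [:: b; - a; - a'] <= F n}.
  by move=> g /[!inE]/or3P[]/eqP->//; exact: F_opp.
move=> /(_ gF).
have := mdistD (i a) (i a') x x'.
have := mdistD (i' (f n a)) (i' (f n a')) y y'.
have := metric_triangle z (i' (f n b)) (y + y').
have := metric_triangle (i' (f n b)) (i' (f n a) + i' (f n a')) (y + y').
have := metric_triangle (i b) (x + x') (i a + i a').
rewrite [mdist z (i' _)]metric_sym [mdist (x + x') (i a + _)]metric_sym.
lra.
Qed.

End Limit.

(** * Intertwining two generic metrics *)

Section Intertwining.
Variables (R : realType) (G : zmodType).
Hypothesis G_countable : countable [set: G].
Hypothesis G_sum : group_isomorphic G (direct_sum G).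

(** Here [generic_extension] asks of [g] only the finitely many estimates that
    [sublinear_control] requires for [d']. *)
Lemma generic_back (d d' : invariant_metrics R G) (f : {additive G -> G})
    (F F' : seq G) (t t' : R) :
  generic d -> generic d' -> 0 < t -> 0 < t' ->
  (forall x, x \in F -> - x \in F) ->
  almost_isometric (norm_of d) (norm_of d') f F t ->
  exists g : {additive G -> G},
    (forall x, x \in F -> norm_of d (g (f x) - x) < t *+ 2) /\
    almost_isometric (norm_of d') (norm_of d) g F' t'.
Proof.
move=> dgen d'gen t0 t'0 F_opp f_isom.
have hN := pseudonorm_norm_of d; have hN' := pseudonorm_norm_of d'.
have [T TP] := sublinear_control F' hN' d'gen.2 t'0.
have t'40 : 0 < t' / 4 by lra.
have [g [gf gT]] :=
  generic_extension G_countable G_sum T dgen hN' t0 t'40 F_opp f_isom.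
exists g; split=> // s sF'.
exact: (TP (norm_of d \o g) (pseudonorm_comp g hN) gT s sF').
Qed.

Definition forth (f : {additive G -> G}) (F : seq G) : seq G := F ++ map f F.

Definition forth_back (E F : seq G) (f g : {additive G -> G}) : seq G :=
  E ++ forth g (forth f F).

Lemma forth_opp (f : {additive G -> G}) (F : seq G) :
  (forall x, x \in F -> - x \in F) ->
  forall x, x \in forth f F -> - x \in forth f F.
Proof.
move=> F_opp x; rewrite !mem_cat => /orP[xF|/mapP[y yF ->]].
  by rewrite F_opp.
by rewrite -raddfN map_f ?orbT// F_opp.
Qed.

Lemma sub_forth (f : {additive G -> G}) (F : seq G) : {subset F <= forth f F}.
Proof. by move=> x xF; rewrite mem_cat xF. Qed.

Lemma map_forth (f : {additive G -> G}) (F : seq G) x :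
  x \in F -> f x \in forth f F.
Proof. by move=> xF; rewrite mem_cat map_f ?orbT. Qed.

(** Both [f' x] and [f x] are compared with [f' (g (f x))]: the first because
    [f'] is almost isometric on [x - g (f x)], the second by assumption. *)
Lemma almost_isometric_step (d d' : invariant_metrics R G)
    (f g f' : {additive G -> G}) (F' : seq G) (x : G) (r s t : R) :
  (forall y, y \in F' -> - y \in F') ->
  almost_isometric (norm_of d) (norm_of d') f' F' t ->
  x \in F' -> g (f x) \in F' ->
  norm_of d (g (f x) - x) < r -> norm_of d' (f' (g (f x)) - f x) < s ->
  norm_of d' (f' x - f x) < r + s + t *+ 2.
Proof.
have hN := pseudonorm_norm_of d; have hN' := pseudonorm_norm_of d'.
move=> F'_opp f'_isom xF gfxF gfx f'gfx.
have := f'_isom [:: x; - g (f x)]; rewrite !big_cons big_nil addr0 raddfB/=.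
rewrite [norm_of d (x - _)](pn_distC hN) ler_norml.
have xgF : {subset [:: x; - g (f x)] <= F'}.
  by move=> y /[!inE]/orP[]/eqP->//; exact: F'_opp.
move=> /(_ xgF); have := pn_tri hN' (f' (g (f x))) (f' x) (f x).
lra.
Qed.

Record intertwined (d d' : invariant_metrics R G)
    (f g : nat -> {additive G -> G}) (F F' : nat -> seq G) : Prop :=
  Intertwined {
    intertwined_0 : forall n, 0 \in F n;
    intertwined_opp : forall n x, x \in F n -> - x \in F n;
    intertwined_opp' : forall n x, x \in F' n -> - x \in F' n;
    intertwined_exhaust : forall x, exists n, x \in F n;
    intertwined_sub : forall n, {subset F n <= F' n};
    intertwined_sub' : forall n, {subset F' n <= F n.+1};
    intertwined_f : forall n x, x \in F n -> f n x \in F' n;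
    intertwined_g : forall n x, x \in F' n -> g n x \in F n.+1;
    intertwined_f_isom : forall n,
      almost_isometric (norm_of d) (norm_of d') (f n) (F n) (weight R n);
    intertwined_g_isom : forall n,
      almost_isometric (norm_of d') (norm_of d) (g n) (F' n) (weight R n);
    intertwined_gf : forall n x, x \in F n ->
      norm_of d (g n (f n x) - x) < weight R n *+ 2;
    intertwined_fg : forall n x, x \in F' n ->
      norm_of d' (f n.+1 (g n x) - x) < weight R n *+ 2 }.

(** The two generic metrics play alternate roles in [generic_back]. Each new
    set contains the images of the previous one, so that the next almost
    isometry is controlled there, and one more element of an enumeration. *)
Lemma exists_intertwined (d d' : invariant_metrics R G) :
  generic d -> generic d' -> exists f g F F', intertwined d d' f g F F'.
Proof.
move=> dgen d'gen; have [e eP] := exists_enumeration 0 G_countable.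
have hN := pseudonorm_norm_of d; have hN' := pseudonorm_norm_of d'.
pose E n := [:: 0; e n; - e n].
have E_opp n x : x \in E n -> - x \in E n.
  by rewrite !inE => /or3P[]/eqP->; rewrite ?oppr0 ?opprK eqxx ?orbT.
pose good n (f : {additive G -> G}) (F : seq G) :=
  (forall x, x \in F -> - x \in F) /\
  almost_isometric (norm_of d) (norm_of d') f F (weight R n).
have cat_opp n (F : seq G) : (forall x, x \in F -> - x \in F) ->
    forall x, x \in E n ++ F -> - x \in E n ++ F.
  move=> F_opp x; rewrite !mem_cat => /orP[/E_opp->//|/F_opp->].
  by rewrite orbT.
have /choice[next nextP] : forall q : nat * {additive G -> G} * seq G,
  exists p : {additive G -> G} * {additive G -> G},
  let: (n, f, F) := q in good n f F ->
  [/\ good n.+1 p.2 (forth_back (E n) F f p.1),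
      almost_isometric (norm_of d') (norm_of d) p.1 (forth f F) (weight R n),
      forall x, x \in F -> norm_of d (p.1 (f x) - x) < weight R n *+ 2 &
      forall x, x \in forth f F ->
        norm_of d' (p.2 (p.1 x) - x) < weight R n *+ 2].
  move=> [[n f] F]; have [[F_opp f_isom]|ngood] := pselect (good n f F); last first.
    by exists (f, f).
  have w0 := weight_gt0 R n; have w1 := weight_gt0 R n.+1.
  have [g [gf g_isom]] :=
    generic_back (forth f F) dgen d'gen w0 w0 F_opp f_isom.
  have F'_opp := @forth_opp f F F_opp.
  have [f' [f'g f'_isom]] :=
    generic_back (forth_back (E n) F f g) d'gen dgen w0 w1 F'_opp g_isom.
  exists (g, f') => _; split=> //; split=> //.
  by apply: cat_opp; exact: forth_opp.
pose st := fix st n : {additive G -> G} * seq G :=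
  if n is m.+1 then
    let: (f, F) := st m in let: p := next (m, f, F) in
    (p.2, forth_back (E m) F f p.1)
  else (idfun : {additive G -> G}, [:: 0]).
pose f n := (st n).1; pose F n := (st n).2.
pose g n := (next (n, f n, F n)).1.
have stS n : st n.+1 = ((next (n, f n, F n)).2, forth_back (E n) (F n) (f n) (g n)).
  by rewrite /g/f/F/=; case: (st n).
have FS n : F n.+1 = forth_back (E n) (F n) (f n) (g n) by rewrite {1}/F stS.
have fS n : f n.+1 = (next (n, f n, F n)).2 by rewrite {1}/f stS.
have st_good n : good n (f n) (F n).
  elim: n => [|n IHn].
    split=> [x|s s0]; first by rewrite !inE => /eqP->; rewrite oppr0.
    rewrite big_seq big1 => [|x /s0]; last by rewrite inE => /eqP.
    by rewrite (pn0 hN) (pn0 hN') subrr normr0 mulrn_wge0// ltW// weight_gt0.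
  by rewrite FS fS; have [] := nextP (n, f n, F n) IHn.
pose F' n := forth (f n) (F n).
have FF' n : {subset F n <= F' n} := @sub_forth (f n) (F n).
have F'F n : {subset F' n <= F n.+1}.
  by move=> x xF'; rewrite FS mem_cat sub_forth ?orbT.
have F0 n : 0 \in F n.
  by case: n => [|n]; rewrite ?FS ?mem_cat ?inE ?eqxx.
have nextE n := nextP (n, f n, F n) (st_good n).
exists f, g, F, F'; split=> //.
- by move=> n; exact: (st_good n).1.
- by move=> n; exact/forth_opp/(st_good n).1.
- by move=> x; have [n <-] := eP x; exists n.+1; rewrite FS !mem_cat !inE eqxx orbT.
- by move=> n x xF; exact: map_forth.
- by move=> n x xF'; rewrite FS mem_cat map_forth ?orbT.
- by move=> n; exact: (st_good n).2.
- by move=> n; have [] := nextE n.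
- by move=> n; have [] := nextE n.
- by move=> n; rewrite fS; have [] := nextE n.
Qed.

Lemma generic_isometric (d d' : invariant_metrics R G) :
  generic d -> generic d' ->
  exists f : {additive completion d -> completion d'},
    bijective f /\ (forall x y, mdist (f x) (f y) = mdist x y).
Proof.
move=> dgen d'gen.
have [f [g [F [F' []]]]] := exists_intertwined dgen d'gen.
move=> F0 F_opp F'_opp F_ex FF' F'F fF' gF f_isom g_isom gf fg.
have f_step n a : a \in F n -> norm_of d' (f n.+1 a - f n a) <= weight R n *+ 6.
  move=> aF; have aF' := FF' _ _ aF.
  have := almost_isometric_step (F_opp _) (f_isom n.+1) (F'F _ _ aF')
    (gF _ _ (fF' _ _ aF)) (gf _ _ aF) (fg _ _ (fF' _ _ aF)).
  by have := weightS R n; have := weight_gt0 R n.+1; lra.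
have g_step n a : a \in F' n -> norm_of d (g n.+1 a - g n a) <= weight R n *+ 6.
  move=> aF'; have gaF := gF _ _ aF'.
  have := almost_isometric_step (F'_opp _) (g_isom n.+1) (FF' _ _ (F'F _ _ aF'))
    (fF' _ _ gaF) (fg _ _ aF') (gf _ _ gaF).
  by have := weightS R n; have := weight_gt0 R n.+1; lra.
have F_le n : {subset F n <= F n.+1} by move=> x /FF'/F'F.
have F'_le n : {subset F' n <= F' n.+1} by move=> x /F'F/FF'.
have F'0 n : 0 \in F' n by exact: FF'.
have F'_ex x : exists n, x \in F' n by have [n /FF'] := F_ex x; exists n.
have /choice[h hP] := limit_graph_total F0 F_opp F_le F_ex f_isom f_step.
(* If [b] approaches [y] and [g n b] approaches [x], then [a := g n b] witnesses
   the converse relation, since [f n.+1 (g n b)] is within [2 * 2 ^- n] of [b]. *)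
have back y x : limit_graph (d := d') (d' := d) g F' y x -> limit_graph f F x y.
  move=> yx t t0; have t20 : 0 < t / 2 by lra.
  have t40 : 0 < t / 4 by lra.
  have [N1 P1] := yx _ t20; have [N2 P2] := weight_small t40.
  exists (maxn N1 N2).+1 => -[//|n]; rewrite ltnS geq_max => /andP[n1 n2].
  have [b bF' [by_ bx]] := P1 n n1; exists (g n b); first exact: gF.
  split; first by apply: lt_trans bx _; lra.
  have := metric_triangle (to_completion d' (f n.+1 (g n b))) (to_completion d' b) y.
  rewrite mdist_to_completion; have := fg n b bF'; have := P2 n n2.
  lra.
have h_isom x y : mdist (h x) (h y) = mdist x y.
  exact: (limit_graph_isometry F_opp f_isom (hP x) (hP y)).
have [h' h'E] : exists h' : {additive completion d -> completion d'},
    forall x, h' x = h x.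
  apply: exists_additive => x y; apply: (addIr (h y)); rewrite subrK.
  apply/esym; apply: (limit_graph_add F_opp f_isom (hP (x - y)) (hP y)).
  by rewrite subrK.
exists h'; split=> [|x y]; last by rewrite !h'E.
have /choice[k kP] := limit_graph_total F'0 F'_opp F'_le F'_ex g_isom g_step.
have hK y : h (k y) = y.
  apply: mdist_positivity.
  rewrite (limit_graph_isometry F_opp f_isom (hP (k y)) (back _ _ (kP y))).
  exact: mdistxx.
exists k => y; rewrite h'E//; apply: mdist_positivity.
by rewrite -h_isom hK mdistxx.
Qed.

End Intertwining.

Theorem theorem0p2 (R : realType) (G : zmodType)
    (G_countable : countable [set: G])
    (G_sum : group_isomorphic G (direct_sum G)) :
  exists2 M : set (invariant_metrics R G),
    comeager M &
    forall d d' : invariant_metrics R G, M d -> M d' ->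
      exists f : {additive completion d -> completion d'},
        bijective f /\ (forall x y, mdist (f x) (f y) = mdist x y).
Proof.
exists [set d | generic d]; first exact: comeager_generic.
by move=> d d'; exact: generic_isometric.
Qed.
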